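(* For all integers $r\ge 0$, $$f(r+4)\le 8\cdot 2^r+9f(r).$$ Hence, writing $g(d)=f(d)/2^d$, one has $g(r+4)\le \tfrac12+\tfrac{9}{16}g(r)$ for all $r\ge 0$, where the map $t\mapsto\tfrac12+\tfrac9{16}t$ has fixed point $\tfrac87$, so that $f(d)\le(\tfrac87+o(1))2^d$ as $d\to\infty$; for example $f(9)\le 625$.
   Context: Write $[3]=\{0,1,2\}$. A proper sub-box of $[3]^d$ is a set $B=S_1\times\dots\times S_d$ with $\varnothing\neq S_i\subsetneq[3]$ for every $1\le i\le d$ (so each side $S_i$ has one or two elements). A double cover of $[3]^d$ is a finite multiset $\{B_1,\dots,B_m\}$ of proper sub-boxes such that every point of $[3]^d$ lies in exactly two of the $B_j$, counted with multiplicity; its size is $m$. $f(d)$ denotes the minimum size of a double cover of $[3]^d$. For $d=0$, $[3]^0$ is a single point, which is itself the only proper sub-box. It is known from earlier work that $[3]^5$ has a double cover with $41$ boxes, i.e. $f(5)\le 41$. *)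

(* Defs.v *)
From mathcomp Require Import all_boot all_order all_algebra.
From mathcomp Require Import reals.

Set Implicit Arguments.
Unset Strict Implicit.
Unset Printing Implicit Defensive.

Import Order.TTheory GRing.Theory Num.Theory.

Local Open Scope nat_scope.

Definition point (d : nat) := {ffun 'I_d -> 'I_3}.

Definition box (d : nat) (S : {ffun 'I_d -> {set 'I_3}}) : {set point d} :=
  [set x : point d | [forall i, x i \in S i]].

Definition proper_box (d : nat) (B : {set point d}) : bool :=
  [exists S : {ffun 'I_d -> {set 'I_3}},
    [forall i, (S i != set0) && (S i \proper [set: 'I_3])] &&
    (B == box S)].

(* A finite multiset of boxes is represented by a sequence enumerating it: the
   notions below are invariant under perm_eq. *)
Definition double_cover (d : nat) (Bs : seq {set point d}) : bool :=
  all (@proper_box d) Bs &&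
  [forall x : point d, count (fun B : {set point d} => x \in B) Bs == 2].

Definition has_double_cover (d m : nat) : bool :=
  [exists Bs : m.-tuple {set point d}, double_cover Bs].

(* Every singleton, taken twice. *)
Lemma ex_double_cover (d : nat) : exists m, has_double_cover d m.
Proof.
pose s := [seq [set x] | x : point d].
exists (size (s ++ s)); apply/existsP; exists (in_tuple (s ++ s)) => /=.
apply/andP; split.
  suff h : all (@proper_box d) s by rewrite all_cat h.
  apply/allP => _ /mapP[x _ ->]; apply/existsP.
  exists [ffun i => [set x i]]; apply/andP; split.
    apply/forallP => i; rewrite ffunE -card_gt0 cards1 /=.
    by rewrite properEcard subsetT cards1 cardsT card_ord.
  apply/eqP/setP => y; rewrite !inE; apply/eqP/forallP => [-> i|h].
    by rewrite ffunE inE.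
  by apply/ffunP => i; have := h i; rewrite ffunE inE => /eqP.
apply/forallP => x; rewrite count_cat.
suff -> : count (fun B : {set point d} => x \in B) s = 1 by [].
rewrite count_map (eq_count (a2 := pred1 x)); last first.
  by move=> y /=; rewrite inE eq_sym.
by rewrite count_uniq_mem ?enum_uniq // mem_enum.
Qed.

Definition f (d : nat) : nat := ex_minn (ex_double_cover d).

Definition g (R : realType) (d : nat) : R := ((f d)%:R / 2 ^+ d)%R.

(* Main.v *)
(* The key object is a configuration in [3]^4 of 8 proper boxes with weight 1
   and 9 proper boxes with weight 2 such that every point has total weight 2.
   Multiplying the weight-1 boxes by a partition of [3]^r into 2^r proper boxes
   (each side split as {0} | {1,2}) and the weight-2 boxes by an optimal double
   cover of [3]^r gives a double cover of [3]^(r+4) of size 8 * 2^r + 9 * f r.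
   Since f 9 <= 8 * 2^5 + 9 * f 5, the last claim needs f 5 <= 41, witnessed by
   an explicit cover found, like the configuration above, by a computer search
   among those invariant under a nontrivial symmetry group of the cube. *)
Require Import Defs.
From mathcomp Require Import all_boot all_order all_algebra.
From mathcomp Require Import classical_sets reals topology normedtype sequences.
From mathcomp Require Import ring lra.

Set Implicit Arguments.
Unset Strict Implicit.
Unset Printing Implicit Defensive.

Import Order.TTheory GRing.Theory Num.Theory.
Import numFieldNormedType.Exports.

(* [classical_sets] also exports a [point]. *)
Local Notation point := Defs.point.

(** * Covering multiplicities and the minimum [f] *)

Definition cover_mult (d : nat) (Bs : seq {set point d}) (x : point d) : nat :=
  count (fun B : {set point d} => x \in B) Bs.

Lemma double_coverP (d : nat) (Bs : seq {set point d}) :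
  all (@proper_box d) Bs -> (forall x, cover_mult Bs x = 2) ->
  double_cover Bs.
Proof.
move=> pB cB; rewrite /double_cover pB /=; apply/forallP => x.
exact/eqP/cB.
Qed.

Lemma f_le_size (d : nat) (Bs : seq {set point d}) :
  double_cover Bs -> f d <= size Bs.
Proof.
move=> dB; rewrite /f; case: ex_minnP => m _; apply.
by apply/existsP; exists (in_tuple Bs).
Qed.

Lemma f_attained (d : nat) :
  exists2 Bs : seq {set point d}, double_cover Bs & size Bs = f d.
Proof.
rewrite /f; case: ex_minnP => m /existsP[Bs dB] _.
by exists Bs; rewrite ?size_tuple.
Qed.

(** * Products of boxes *)

Definition lpoint (r s : nat) (x : point (r + s)) : point r :=
  [ffun i => x (lshift s i)].

Definition rpoint (r s : nat) (x : point (r + s)) : point s :=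
  [ffun i => x (rshift r i)].

Definition box_prod (r s : nat) (A : {set point r}) (B : {set point s}) :
    {set point (r + s)} :=
  [set x | (lpoint x \in A) && (rpoint x \in B)].

Lemma proper_box_prod (r s : nat) (A : {set point r}) (B : {set point s}) :
  proper_box A -> proper_box B -> proper_box (box_prod A B).
Proof.
move=> /existsP[S /andP[/forallP pS /eqP ->]].
move=> /existsP[T /andP[/forallP pT /eqP ->]].
pose U := [ffun i => match split i with inl j => S j | inr k => T k end].
have Ul j : U (lshift s j) = S j by rewrite ffunE (unsplitK (inl j)).
have Ur k : U (rshift r k) = T k by rewrite ffunE (unsplitK (inr k)).
apply/existsP; exists U; apply/andP; split.
  by apply/forallP => i; rewrite ffunE; case: split.
apply/eqP/finset.setP => x; rewrite !inE.
apply/andP/forallP => [[/forallP hS /forallP hT] i|h].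
  rewrite -(splitK i); case: (split i) => j /=.
    by rewrite Ul; have := hS j; rewrite ffunE.
  by rewrite Ur; have := hT j; rewrite ffunE.
split; apply/forallP => j; rewrite ffunE.
  by have := h (lshift s j); rewrite Ul.
by have := h (rshift r j); rewrite Ur.
Qed.

Lemma count_allpairs (S T U : Type) (g : S -> T -> U) (a : pred U)
    (b : pred S) (c : pred T) (s : seq S) (t : seq T) :
  (forall x y, a (g x y) = b x && c y) ->
  count a [seq g x y | x <- s, y <- t] = count b s * count c t.
Proof.
move=> E; elim: s => //= x s IH; rewrite count_cat IH mulnDl; congr (_ + _).
rewrite count_map (eq_count (a2 := fun y => b x && c y)); last exact: E.
by case: (b x); rewrite ?mul1n // mul0n count_pred0.
Qed.

Definition box_prods (r s : nat) (As : seq {set point r})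
    (Bs : seq {set point s}) : seq {set point (r + s)} :=
  [seq box_prod A B | A <- As, B <- Bs].

Lemma all_proper_box_prods (r s : nat) (As : seq {set point r})
    (Bs : seq {set point s}) :
  all (@proper_box r) As -> all (@proper_box s) Bs ->
  all (@proper_box (r + s)) (box_prods As Bs).
Proof.
move=> /allP pA /allP pB; apply/allP => _ /allpairsP[[A B] [/= hA hB ->]].
by apply: proper_box_prod; [apply: pA | apply: pB].
Qed.

Lemma cover_mult_prods (r s : nat) (As : seq {set point r})
    (Bs : seq {set point s}) (x : point (r + s)) :
  cover_mult (box_prods As Bs) x =
  cover_mult As (lpoint x) * cover_mult Bs (rpoint x).
Proof. by apply: count_allpairs => A B; rewrite inE. Qed.

(** * The dyadic partition and the product bound *)

Definition dyadic_side (b : bool) : {set 'I_3} :=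
  if b then [set ord0] else ~: [set ord0].

Definition dyadic_boxes (d : nat) : seq {set point d} :=
  [seq box [ffun i => dyadic_side (t i)] | t : {ffun 'I_d -> bool}].

Lemma size_dyadic_boxes (d : nat) : size (dyadic_boxes d) = 2 ^ d.
Proof. by rewrite size_map -cardE card_ffun card_bool card_ord. Qed.

Lemma all_proper_dyadic_boxes (d : nat) :
  all (@proper_box d) (dyadic_boxes d).
Proof.
apply/allP => _ /mapP[t _ ->]; apply/existsP.
exists [ffun i => dyadic_side (t i)]; rewrite eqxx andbT.
apply/forallP => i; rewrite ffunE -card_gt0 properEcard.
rewrite finset.subsetT cardsT card_ord.
by case: (t i); rewrite /= ?cards1 // cardsC1 card_ord.
Qed.

Lemma cover_mult_dyadic_boxes (d : nat) (x : point d) :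
  cover_mult (dyadic_boxes d) x = 1.
Proof.
rewrite /cover_mult count_map.
(* The only dyadic box through [x] is the one whose index records which coordinates of [x] are
   zero. *)
rewrite (eq_count (a2 := pred1 [ffun i => x i == ord0])); last first.
  move=> t /=; rewrite inE; apply/forallP/eqP => [h|-> i].
    apply/ffunP => i; have := h i; rewrite !ffunE /dyadic_side.
    by case: (t i); rewrite !inE => // /negPf.
  by rewrite !ffunE /dyadic_side; case: ifP; rewrite !inE => // ->.
by rewrite count_uniq_mem ?enum_uniq // mem_enum.
Qed.

(** The dyadic partition taken twice is a double cover. This gives [g R d <= 2], the base case of
    the asymptotic bound. *)
Lemma f_le_double_pow (d : nat) : f d <= 2 * 2 ^ d.
Proof.
rewrite mul2n -addnn -size_dyadic_boxes -size_cat; apply: f_le_size.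
apply: double_coverP => [|x]; first by rewrite all_cat all_proper_dyadic_boxes.
by rewrite /cover_mult count_cat -/(cover_mult _ _) cover_mult_dyadic_boxes.
Qed.

(** Multiplicities multiply in products. The partition of the first factor has multiplicity 1 and
    its double cover has multiplicity 2, which are the weights of [Ss] and [Ds]. *)
Lemma f_add_le (r s : nat) (Ss Ds : seq {set point s}) :
  all (@proper_box s) Ss -> all (@proper_box s) Ds ->
  (forall x, cover_mult Ss x + 2 * cover_mult Ds x = 2) ->
  f (r + s) <= size Ss * 2 ^ r + size Ds * f r.
Proof.
move=> pS pD cover2; have [Bs /andP[pB /forallP cB] <-] := f_attained r.
rewrite -size_dyadic_boxes [size Ss * _]mulnC [size Ds * _]mulnC.
rewrite -(size_allpairs (@box_prod r s)) -(size_allpairs (@box_prod r s) Bs).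
rewrite -size_cat; apply: f_le_size; apply: double_coverP => [|x].
  by rewrite all_cat !all_proper_box_prods // all_proper_dyadic_boxes.
rewrite /cover_mult count_cat -!/(cover_mult _ _) !cover_mult_prods.
rewrite cover_mult_dyadic_boxes mul1n.
by rewrite [cover_mult Bs _](eqP (cB (lpoint x))) cover2.
Qed.

(* A side is coded by the bit mask of its elements: m with 0 < m < 7 stands for
   the set of those a with bit a of m equal to 1. *)
Definition in_side (m a : nat) : bool := odd (iter a half m).

Definition code_box (d : nat) (c : seq nat) : {set point d} :=
  box [ffun i : 'I_d => [set a : 'I_3 | in_side (nth 0 c i) a]].

Definition valid_code (d : nat) (c : seq nat) : bool :=
  (size c == d) && all (fun m => 0 < m < 7) c.

Lemma proper_code_box (d : nat) (c : seq nat) :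
  valid_code d c -> proper_box (code_box d c).
Proof.
move=> /andP[/eqP sc /allP hc]; apply/existsP.
exists [ffun i : 'I_d => [set a : 'I_3 | in_side (nth 0 c i) a]].
rewrite eqxx andbT; apply/forallP => i; rewrite ffunE.
have : 0 < nth 0 c i < 7 by apply/hc/mem_nth; rewrite sc.
move: (nth 0 c i) => m hm.
(* Turns a search through 0, 1, 2, decided by computation for each mask from 1 to 6, into an element
   of ['I_3]. *)
have ex (P : pred nat) : has P (iota 0 3) -> exists a : 'I_3, P a.
  by move=> /hasP[a]; rewrite mem_iota => a3 Pa; exists (Ordinal a3).
have in_m : exists a : 'I_3, in_side m a.
  by apply: ex; case: m hm => [|[|[|[|[|[|[|m]]]]]]].
have notin_m : exists a : 'I_3, ~~ in_side m a.
  apply: (ex (fun a => ~~ in_side m a)).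
  by case: m hm {in_m} => [|[|[|[|[|[|[|m]]]]]]].
rewrite finset.properEneq finset.subsetT andbT; apply/andP; split.
  by case: in_m => a ha; apply/finset.set0Pn; exists a; rewrite inE.
by case: notin_m => a; apply: contraNneq => /finset.setP/(_ a);
   rewrite !inE => ->.
Qed.

(** Membership restated on plain lists, so that cover conditions can be decided by [vm_compute]. For
    lists of equal length the catch-all [true] is reached only at the end, as an empty
    conjunction. *)
Fixpoint in_code (c w : seq nat) : bool :=
  match c, w with
  | m :: c', a :: w' => in_side m a && in_code c' w'
  | _, _ => true
  end.

Fixpoint words (d : nat) : seq (seq nat) :=
  if d is d'.+1 then [seq a :: w | a <- iota 0 3, w <- words d'] else [:: [::]].

Definition word (d : nat) (x : point d) : seq nat :=
  [seq val (x i) | i <- enum 'I_d].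

Lemma word_mem_words (d : nat) (x : point d) : word x \in words d.
Proof.
rewrite /word; elim: d x => [|d IH] x; first by rewrite enum_ord0.
rewrite enum_ordSl map_cons -map_comp; apply: (@allpairs_f _ _ _ cons).
  by rewrite mem_iota ltn_ord.
have := IH [ffun i => x (lift ord0 i)].
by under eq_map => i do rewrite ffunE.
Qed.

Lemma mem_code_box (d : nat) (c : seq nat) (x : point d) :
  size c = d -> (x \in code_box d c) = in_code c (word x).
Proof.
rewrite /word => sc; rewrite inE.
transitivity [forall i : 'I_d, in_side (nth 0 c i) (x i)].
  by apply: eq_forallb => i; rewrite ffunE inE.
elim: d c x sc => [|d IH] [|m c] x //= sc.
  by apply/forallP => -[].
rewrite enum_ordSl /= -map_comp; case: sc => sc.
have := IH c [ffun i => x (lift ord0 i)] sc.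
under [X in in_code _ X]eq_map => i do rewrite ffunE.
move=> <-; apply/forallP/andP => [h|[h0 /forallP h] i].
  split; first exact: (h ord0).
  by apply/forallP => i; rewrite ffunE; apply: (h (lift ord0 i)).
case: (unliftP ord0 i) => [j ->|-> //].
by have := h j; rewrite ffunE.
Qed.

Lemma all_proper_code_boxes (d : nat) (cs : seq (seq nat)) :
  all (valid_code d) cs -> all (@proper_box d) (map (code_box d) cs).
Proof. by rewrite all_map; apply: sub_all => c; apply: proper_code_box. Qed.

Lemma cover_mult_code_boxes (d : nat) (cs : seq (seq nat)) (x : point d) :
  all (valid_code d) cs ->
  cover_mult (map (code_box d) cs) x = count (in_code^~ (word x)) cs.
Proof.
move=> /allP vcs; rewrite /cover_mult count_map; apply: eq_in_count => c hc.
by rewrite /= mem_code_box //; case/andP: (vcs c hc) => /eqP.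
Qed.

(** * The explicit configurations in dimensions 4 and 5 *)

Definition codes4_single : seq (seq nat) :=
  [:: [:: 3; 3; 3; 3]; [:: 6; 5; 5; 5]; [:: 3; 6; 6; 6]; [:: 5; 5; 3; 3];
    [:: 6; 3; 6; 5]; [:: 3; 6; 5; 3]; [:: 6; 5; 3; 6]; [:: 5; 6; 6; 5]].

(** One box is a single point and the other eight have two points, while each weight-1 box has 16
    points. The total weight is 8 * 16 + 2 * (1 + 8 * 2) = 162 = 2 * 81, as it must be. *)
Definition codes4_double : seq (seq nat) :=
  [:: [:: 2; 4; 2; 1]; [:: 1; 1; 4; 5]; [:: 3; 1; 4; 2]; [:: 4; 5; 4; 2];
    [:: 4; 2; 6; 2]; [:: 4; 2; 1; 3]; [:: 6; 2; 1; 4]; [:: 1; 6; 1; 4];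
    [:: 1; 1; 3; 4]].

(** The family is invariant under the involution that swaps 0 and 2 in the first three coordinates
    and 0 and 1 in the fourth. It consists of 19 pairs, listed consecutively, and 3 fixed boxes. *)
Definition codes5 : seq (seq nat) :=
  [:: [:: 5; 3; 5; 6; 2]; [:: 5; 6; 5; 5; 2]; [:: 5; 3; 3; 6; 5];
    [:: 5; 6; 6; 5; 5]; [:: 5; 3; 4; 6; 5]; [:: 5; 6; 1; 5; 5];
    [:: 3; 3; 3; 3; 4]; [:: 6; 6; 6; 3; 4]; [:: 3; 5; 3; 5; 4];
    [:: 6; 5; 6; 6; 4]; [:: 1; 5; 2; 6; 2]; [:: 4; 5; 2; 5; 2];
    [:: 1; 4; 3; 2; 5]; [:: 4; 1; 6; 1; 5]; [:: 1; 6; 2; 3; 2];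
    [:: 4; 3; 2; 3; 2]; [:: 3; 5; 4; 5; 1]; [:: 6; 5; 1; 6; 1];
    [:: 1; 4; 6; 2; 5]; [:: 4; 1; 3; 1; 5]; [:: 3; 3; 4; 3; 5];
    [:: 6; 6; 1; 3; 5]; [:: 1; 4; 5; 2; 6]; [:: 4; 1; 5; 1; 6];
    [:: 3; 5; 3; 5; 3]; [:: 6; 5; 6; 6; 3]; [:: 3; 3; 3; 3; 3];
    [:: 6; 6; 6; 3; 3]; [:: 3; 3; 4; 3; 2]; [:: 6; 6; 1; 3; 2];
    [:: 1; 4; 5; 2; 3]; [:: 4; 1; 5; 1; 3]; [:: 3; 2; 2; 4; 2];
    [:: 6; 2; 2; 4; 2]; [:: 5; 2; 2; 4; 2]; [:: 2; 2; 3; 4; 5];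
    [:: 2; 2; 6; 4; 5]; [:: 2; 2; 5; 4; 3]; [:: 2; 2; 5; 4; 6];
    [:: 3; 5; 4; 5; 6]; [:: 6; 5; 1; 6; 6]].

Lemma f_add4_le (r : nat) : f (r + 4) <= 8 * 2 ^ r + 9 * f r.
Proof.
have vs : all (valid_code 4) codes4_single by [].
have vd : all (valid_code 4) codes4_double by [].
have := @f_add_le r 4 (map (code_box 4) codes4_single)
  (map (code_box 4) codes4_double).
rewrite !size_map; apply; [exact: all_proper_code_boxes..|move=> x].
rewrite !cover_mult_code_boxes //.
have : all (fun w => count (in_code^~ w) codes4_single +
    2 * count (in_code^~ w) codes4_double == 2) (words 4) by vm_compute.
by move=> /allP/(_ _ (word_mem_words x))/eqP.
Qed.

Lemma f5_le : f 5 <= 41.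
Proof.
have v5 : all (valid_code 5) codes5 by [].
rewrite -[41]/(size codes5) -(size_map (code_box 5)).
apply/f_le_size/double_coverP => [|x]; first exact: all_proper_code_boxes.
rewrite cover_mult_code_boxes //.
have : all (fun w => count (in_code^~ w) codes5 == 2) (words 5) by vm_compute.
by move=> /allP/(_ _ (word_mem_words x))/eqP.
Qed.

(** * The normalised recursion and its limit *)

Local Open Scope classical_set_scope.
Local Open Scope ring_scope.

Lemma g_add4_le (R : realType) (r : nat) :
  g R (r + 4) <= 1 / 2 + 9 / 16 * g R r.
Proof.
rewrite /g ler_pdivrMr ?exprn_gt0 //.
have -> : (1 / 2 + 9 / 16 * ((f r)%:R / 2 ^+ r)) * 2 ^+ (r + 4) =
          8 * 2 ^+ r + 9 * (f r)%:R :> R.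
  have q0 : 2 ^+ r != 0 :> R by rewrite expf_neq0 ?pnatr_eq0.
  by rewrite exprD; field.
by rewrite -natrX -!natrM -natrD ler_nat f_add4_le.
Qed.

(* The ratio 9/10 satisfies (9/10)^4 >= 9/16, which absorbs the contraction of
   the recursion over each of the four residues mod 4 at once. *)
Lemma g_le_geometric (R : realType) (d : nat) :
  g R d <= 8 / 7 + 2 * (9 / 10) ^+ d.
Proof.
have [n] := ubnP d; elim: n d => // n IH d; rewrite ltnS => dn.
have [d4|d4] := ltnP d 4; last first.
  have := IH (d - 4)%N; rewrite (leq_trans _ dn) ?ltn_subrL ?(leq_trans _ d4) //.
  move=> /(_ isT) h; rewrite -(subnK d4); apply: le_trans (g_add4_le _ _) _.
  have q0 : 0 <= (9 / 10) ^+ (d - 4) :> R by rewrite exprn_ge0 //; lra.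
  rewrite exprD; lra.
have g2 : g R d <= 2.
  by rewrite /g ler_pdivrMr ?exprn_gt0 // -natrX -natrM ler_nat f_le_double_pow.
apply: le_trans g2 _.
(* Here [d] is at most 3, and the factor 2 in the bound is large enough: 8/7 + 2 * (9/10)^3 > 2. *)
have : (9 / 10) ^+ 3 <= (9 / 10) ^+ d :> R by rewrite ler_wiXn2l //; lra.
lra.
Qed.

Theorem theorem7p3 (R : realType) :
  [/\ (forall r : nat, (f (r + 4) <= 8 * 2 ^ r + 9 * f r)%N),
      (forall r : nat, g R (r + 4) <= 1 / 2 + 9 / 16 * g R r),
      (1 / 2 + 9 / 16 * (8 / 7) = 8 / 7 :> R),
      (exists eps : nat -> R,
         (eps n @[n --> \oo] --> (0 : R)) /\
         (forall d : nat, (f d)%:R <= (8 / 7 + eps d) * 2 ^+ d)) &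
      (f 9 <= 625)%N].
Proof.
split.
- exact: f_add4_le.
- exact: g_add4_le.
- by field.
- exists (geometric 2 (9 / 10)); split.
    by apply: cvg_geometric; rewrite ger0_norm; lra.
  move=> d; rewrite -ler_pdivrMr ?exprn_gt0 //; exact: g_le_geometric.
- apply: leq_trans (f_add4_le 5) _.
  (* The number 625 is read as 8 * 2^5 + 9 * 41. *)
  by rewrite (leq_add2l _ _ (9 * 41)) leq_mul2l f5_le.
Qed.
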